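(* Let $M\in\mathbb{C}^{m\times n}$, $U\in\mathbb{C}^{m\times\ell}$, $V\in\mathbb{C}^{n\times q}$ and $\Sigma\in\mathbb{D}^{\ell\times q}$ with positive pairwise distinct diagonal entries. Put $\Delta=U^*MV-\Sigma$, $\varepsilon_1=\|\Delta\|$, $\kappa=\kappa(\Sigma)$, $K=K(\Sigma)$. 1. If $\kappa^{5/4}K^{2/5}\varepsilon_1\le\varepsilon\le 0.1$, then the triplet $(U_1,V_1,\Sigma_1)=\mathrm{DS}(U,V,\Sigma)$ satisfies $$\|U_1^*MV_1-\Sigma_1\|\le(8+18\varepsilon+33\varepsilon^2)\,\varepsilon^3 .$$ 2. If $\kappa^{6/5}K^{3/10}\varepsilon_1\le\varepsilon\le 0.1$, then the triplet $(\bar U_1,\bar V_1,\bar\Sigma_1)=\overline{\mathrm{DS}}(U,V,\Sigma)$ satisfies $$\|\bar U_1^*M\bar V_1-\bar\Sigma_1\|\le(6+21\varepsilon+54\varepsilon^2)\,\varepsilon^3 .$$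
   Context: Dimensions: $m\ge n$, $1\le\ell\le m$, $1\le q\le n$, $\ell\ge q$. $A^*$ is the conjugate transpose. $\mathbb{D}^{\ell\times q}$ is the set of real $\ell\times q$ matrices whose top $q\times q$ block is $\mathrm{diag}(\sigma_1,\dots,\sigma_q)$ and whose other rows vanish. Norm: $\|A\|=\max(\|A\|_1,\|A^*\|_1)$ with $\|A\|_1=\max_i\sum_j|A_{i,j}|$. For $\Sigma$ with diagonal entries $\sigma_i$: $\kappa(\Sigma)=\max\Big(1,\max_{i}\frac1{|\sigma_i|},\max_{i\ne j}\big(\frac1{|\sigma_i-\sigma_j|}+\frac1{|\sigma_i+\sigma_j|}\big)\Big)$ and $K(\Sigma)=\max(1,\max_i\sigma_i)$. Canonical solution: given $D=(\delta_{i,j})\in\mathbb{C}^{\ell\times q}$, the equation $X\Sigma-\Sigma Y+S=D$ is solved by the following $S\in\mathbb{D}^{\ell\times q}$ and skew Hermitian $X\in\mathbb{C}^{\ell\times\ell}$, $Y\in\mathbb{C}^{q\times q}$: $S_{i,i}=\mathrm{Re}\,\delta_{i,i}$, $x_{i,i}=-y_{i,i}=\frac{\mathrm{Im}\,\delta_{i,i}}{2\sigma_i}\sqrt{-1}$ for $1\le i\le q$; for $1\le i<j\le q$, $x_{i,j}=\frac12\big(\frac{\delta_{i,j}+\overline{\delta_{j,i}}}{\sigma_j-\sigma_i}+\frac{\delta_{i,j}-\overline{\delta_{j,i}}}{\sigma_j+\sigma_i}\big)$ and $y_{i,j}=\frac12\big(\frac{\delta_{i,j}+\overline{\delta_{j,i}}}{\sigma_j-\sigma_i}-\frac{\delta_{i,j}-\overline{\delta_{j,i}}}{\sigma_j+\sigma_i}\big)$;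 $x_{i,j}=\delta_{i,j}/\sigma_j$ for $q<i\le\ell$, $1\le j\le q$; $x_{i,j}=0$ for $q<i,j\le\ell$; remaining entries by skew Hermitian symmetry. Let $(S_1,X_1,Y_1)$ be the canonical solution of $X_1\Sigma-\Sigma Y_1+S_1=\Delta$, and $(S_2,X_2,Y_2)$ the canonical solution of $X_2\Sigma-\Sigma Y_2+S_2=-\tfrac12X_1(\Delta+S_1)+\tfrac12(\Delta+S_1)Y_1$. Put $S=S_1+S_2$, $X=X_1+X_2$, $Y=Y_1+Y_2$. Then $$\mathrm{DS}(U,V,\Sigma)=\big(U(I_\ell+X+\tfrac12X_1^2),\ V(I_q+Y+\tfrac12Y_1^2),\ \Sigma+S\big),$$ $$\overline{\mathrm{DS}}(U,V,\Sigma)=\big(U(I_\ell+X+\tfrac12X^2),\ V(I_q+Y+\tfrac12Y^2),\ \Sigma+S\big).$$ *)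

(* Defs.v *)
From mathcomp Require Import all_boot all_order all_algebra.
From mathcomp Require Import complex reals exp.
Set Implicit Arguments.
Unset Strict Implicit.
Unset Printing Implicit Defensive.
Import Order.TTheory GRing.Theory Num.Theory.
Local Open Scope ring_scope.
Local Open Scope sesquilinear_scope.

Section Defs.
Variable R : realType.
Local Notation C := R[i].

(* The complex modulus, with values in [R] (the norm of [R[i]] lands in
   [R[i]]), is [Normc.normc]. *)
Definition norm1 m n (A : 'M[C]_(m, n)) : R :=
  \big[Num.max/0]_(i < m) \sum_(j < n) Normc.normc (A i j).

Definition mxnorm m n (A : 'M[C]_(m, n)) : R :=
  Num.max (norm1 A) (norm1 (A ^t*)).

Definition toC m n (A : 'M[R]_(m, n)) : 'M[C]_(m, n) :=
  map_mx (fun x : R => x%:C%C) A.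

(* Real l x q matrices vanishing off the main diagonal: for q <= l, a diagonal
   q x q block on top of zero rows. *)
Definition diagonal_rect l q (A : 'M[R]_(l, q)) : Prop :=
  forall (i : 'I_l) (j : 'I_q), i != j :> nat -> A i j = 0.

Section Canonical.
Variables (l q : nat) (hql : (q <= l)%N).

Definition diag (T : Type) (A : 'M[T]_(l, q)) (i : 'I_q) : T :=
  A (widen_ord hql i) i.

Definition kappa (Sigma : 'M[R]_(l, q)) : R :=
  let s := diag Sigma in
  Num.max 1 (Num.max
    (\big[Num.max/0]_(i < q) (1 / `|s i|))
    (\big[Num.max/0]_(p : 'I_q * 'I_q | p.1 != p.2)
       (1 / `|s p.1 - s p.2| + 1 / `|s p.1 + s p.2|))).

Definition bigK (Sigma : 'M[R]_(l, q)) : R :=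
  Num.max 1 (\big[Num.max/0]_(i < q) diag Sigma i).

Section Solution.
Variables (Sigma : 'M[R]_(l, q)) (D : 'M[C]_(l, q)).
Let s := diag Sigma.
Let d (i j : 'I_q) : C := D (widen_ord hql i) j.

Definition canS : 'M[R]_(l, q) :=
  \matrix_(i < l, j < q) (if i == j :> nat then complex.Re (D i j) else 0).

Definition can_diag (i : 'I_q) : C :=
  (0 +i* (complex.Im (d i i) / (2 * s i)))%C.

Definition canX_upper (i j : 'I_q) : C :=
  1 / 2 * ((d i j + (d j i)^*) / (s j - s i)%:C%C
           + (d i j - (d j i)^*) / (s j + s i)%:C%C).

Definition canY_upper (i j : 'I_q) : C :=
  1 / 2 * ((d i j + (d j i)^*) / (s j - s i)%:C%C
           - (d i j - (d j i)^*) / (s j + s i)%:C%C).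

Definition canX_square (i j : 'I_q) : C :=
  if (i < j)%N then canX_upper i j
  else if i == j then can_diag i
  else - (canX_upper j i)^*.

Definition canY : 'M[C]_q :=
  \matrix_(i < q, j < q)
    (if (i < j)%N then canY_upper i j
     else if i == j then - can_diag i
     else - (canY_upper j i)^*).

(* [insub i] is [Some i'] with [i' : 'I_q] of the same value as [i] when
   [i < q], and [None] otherwise. *)
Definition canX : 'M[C]_l :=
  \matrix_(i < l, j < l)
    match (insub (val i) : option 'I_q), (insub (val j) : option 'I_q) with
    | Some i', Some j' => canX_square i' j'
    | None, Some j' => D i j' / (s j')%:C%C
    | Some i', None => - (D j i' / (s i')%:C%C)^*
    | None, None => 0
    end.

End Solution.

Section Iterates.
Variables (m n : nat) (M : 'M[C]_(m, n)).
Variables (U : 'M[C]_(m, l)) (V : 'M[C]_(n, q)) (Sigma : 'M[R]_(l, q)).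

Definition Delta : 'M[C]_(l, q) := U ^t* *m M *m V - toC Sigma.

Definition S1 := canS Delta.
Definition X1 := canX Sigma Delta.
Definition Y1 := canY Sigma Delta.

Definition rhs2 : 'M[C]_(l, q) :=
  - ((1 / 2) *: (X1 *m (Delta + toC S1)))
  + (1 / 2) *: ((Delta + toC S1) *m Y1).

Definition S2 := canS rhs2.
Definition X2 := canX Sigma rhs2.
Definition Y2 := canY Sigma rhs2.

Definition DS : 'M[C]_(m, l) * 'M[C]_(n, q) * 'M[R]_(l, q) :=
  (U *m (1%:M + (X1 + X2) + (1 / 2) *: (X1 *m X1)),
   V *m (1%:M + (Y1 + Y2) + (1 / 2) *: (Y1 *m Y1)),
   Sigma + (S1 + S2)).

Definition DSbar : 'M[C]_(m, l) * 'M[C]_(n, q) * 'M[R]_(l, q) :=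
  (U *m (1%:M + (X1 + X2) + (1 / 2) *: ((X1 + X2) *m (X1 + X2))),
   V *m (1%:M + (Y1 + Y2) + (1 / 2) *: ((Y1 + Y2) *m (Y1 + Y2))),
   Sigma + (S1 + S2)).

End Iterates.
End Canonical.
End Defs.

(* Main.v *)
Require Import Defs.
From mathcomp Require Import all_boot all_order all_algebra.
From mathcomp Require Import complex reals exp.
From mathcomp Require Import ring lra.
Import Order.TTheory GRing.Theory Num.Theory.
Local Open Scope ring_scope.
Local Open Scope sesquilinear_scope.

(* Write [X = X1 + X2], [Y = Y1 + Y2] and [U^* M V = Sigma + Delta]. As [X] and
   [Y] are skew Hermitian, the new residual is
   [(I - X + X'^2/2) (Sigma + Delta) (I + Y + Y'^2/2) - Sigma - S] with
   [X', Y'] either [X1, Y1] or [X, Y]. The equations solved by [(S1, X1, Y1)]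
   and [(S2, X2, Y2)] cancel its terms of orders one and two; substituting them
   once more into the remaining terms removes [Sigma] from as many of them as
   possible and merges several cubic terms, which is what keeps the leading
   coefficients below 8 and 6.

   Canonical solutions satisfy [||Y|| <= kappa ||D||] but only
   [||X|| <= (3/2) kappa ||D||]. The loss is recovered as follows: if [q >= 2]
   then two distinct singular values force [kappa K >= 1 + sqrt 2], so that the
   powers of [kappa] and [K] in the hypothesis leave room; if [q = 1] then
   [||X|| <= kappa ||D||] and [||Y|| <= kappa ||D|| / 2]. *)

(** * Expansion of the residuals *)

Section ResidualIdentities.
Set Implicit Arguments.
Unset Strict Implicit.
Variables (F : numFieldType) (l q : nat).
Variables (X1 X2 : 'M[F]_l) (Y1 Y2 : 'M[F]_q) (G D S1 S2 D2 : 'M[F]_(l, q)).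
(* Kept abstract: unifying literal [1 / 2] across the several ring structures of
   [R[i]] does not terminate in reasonable time. *)
Variables (h h4 : F).
Local Notation P := (D + S1).
Local Notation X := (X1 + X2).
Local Notation Y := (Y1 + Y2).
Hypothesis hE : h = 1 / 2.
Hypothesis h4E : h4 = 1 / 4.
Hypothesis first_order : X1 *m G - G *m Y1 + S1 = D.
Hypothesis second_order : X2 *m G - G *m Y2 + S2 = D2.
Hypothesis second_rhs : D2 = - (h *: (X1 *m P)) + h *: (P *m Y1).

Let entryD (A B : 'M[F]_(l, q)) i j : (A + B) i j = A i j + B i j.
Proof. by rewrite mxE. Qed.
Let entryN (A : 'M[F]_(l, q)) i j : (- A) i j = - A i j.
Proof. by rewrite mxE. Qed.
Let entryZ a (A : 'M[F]_(l, q)) i j : (a *: A) i j = a * A i j.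
Proof. by rewrite mxE. Qed.

Let oppD n1 n2 (A B : 'M[F]_(n1, n2)) : - (A + B) = - A - B.
Proof. exact: opprD. Qed.

Let S2E : S2 = D2 - X2 *m G + G *m Y2.
Proof.
by rewrite -second_order; apply/matrixP => i j; rewrite !(entryD, entryN); ring.
Qed.

Let scaleAl n1 n2 n3 a (A : 'M[F]_(n1, n2)) (B : 'M[F]_(n2, n3)) :
  (a *: A) *m B = a *: (A *m B).
Proof. by rewrite scalemxAl. Qed.
Let scaleAr n1 n2 n3 a (A : 'M[F]_(n1, n2)) (B : 'M[F]_(n2, n3)) :
  A *m (a *: B) = a *: (A *m B).
Proof. by rewrite scalemxAr. Qed.

(** Count [X1], [Y1], [S1], [D] as order one and [X2], [Y2], [S2] as order two. The terms are listed
    by increasing order, from three to five, and the only cubic one containing [G] is the first. *)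
Lemma DS_residual :
  (1%:M - (X1 + X2) + h *: (X1 *m X1)) *m (G + D)
    *m (1%:M + (Y1 + Y2) + h *: (Y1 *m Y1)) - (G + (S1 + S2)) =
  - (G *m (Y1 *m Y2 + Y2 *m Y1)) - X2 *m D + S1 *m Y2 + S2 *m Y1
  + h *: (X1 *m X1 *m D) - h *: (S1 *m (Y1 *m Y1))
  - X2 *m G *m Y2 - X1 *m D *m Y2 - X2 *m D *m Y1
  + h *: (X1 *m X1 *m G *m Y2) - h *: (X2 *m G *m (Y1 *m Y1))
  + h *: (X1 *m X1 *m D *m Y1) - h *: (X1 *m D *m (Y1 *m Y1))
  + h4 *: (X1 *m X1 *m G *m (Y1 *m Y1))
  - X2 *m D *m Y2
  + h *: (X1 *m X1 *m D *m Y2) - h *: (X2 *m D *m (Y1 *m Y1))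
  + h4 *: (X1 *m X1 *m D *m (Y1 *m Y1)).
Proof.
(* Eliminating [S2], [D2] and [D] leaves an identity between noncommutative polynomials. Once both
   sides are sums of left-associated products, the entries of these products are atoms for
   [field]. *)
rewrite S2E second_rhs -first_order.
do 5 (rewrite ?mulmxDl ?mulmxDr ?scalerDr ?oppD).
rewrite ?mul1mx ?mulmx1.
do 3 (rewrite ?mulNmx ?mulmxN ?scalerN).
do 3 (rewrite ?scaleAl ?scaleAr).
rewrite ?scalerA ?mulmxA.
apply/matrixP => i j; rewrite !(entryD, entryN, entryZ) ?h4E hE.
by field.
Qed.

(** Both outer factors are truncated exponentials, so up to order three [G] enters only through
    [Z *m G - G *m W], which the canonical equations turn into a small matrix. Only the fourth order
    keeps [G] itself. *)
Let skew_expansion (Z : 'M[F]_l) (W : 'M[F]_q) :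
  (1%:M - Z + h *: (Z *m Z)) *m G *m (1%:M + W + h *: (W *m W)) =
  G - (Z *m G - G *m W) + h *: (Z *m (Z *m G - G *m W))
  - h *: ((Z *m G - G *m W) *m W) + h *: (Z *m (Z *m G - G *m W) *m W)
  + h4 *: (Z *m Z *m G *m (W *m W)).
Proof.
do 5 (rewrite ?mulmxDl ?mulmxDr ?scalerDr ?oppD).
rewrite ?mul1mx ?mulmx1.
do 3 (rewrite ?mulNmx ?mulmxN ?scalerN).
do 3 (rewrite ?scaleAl ?scaleAr).
rewrite ?scalerA ?mulmxA.
apply/matrixP => i j; rewrite !(entryD, entryN, entryZ) ?h4E hE.
by field.
Qed.

Let sandwich_expansion (Z : 'M[F]_l) (W : 'M[F]_q) :
  (1%:M - Z + h *: (Z *m Z)) *m D *m (1%:M + W + h *: (W *m W)) =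
  D - Z *m D + D *m W + h *: (Z *m Z *m D) + h *: (D *m (W *m W))
  - Z *m D *m W + h *: (Z *m Z *m D *m W) - h *: (Z *m D *m (W *m W))
  + h4 *: (Z *m Z *m D *m (W *m W)).
Proof.
do 5 (rewrite ?mulmxDl ?mulmxDr ?scalerDr ?oppD).
rewrite ?mul1mx ?mulmx1.
do 3 (rewrite ?mulNmx ?mulmxN ?scalerN).
do 3 (rewrite ?scaleAl ?scaleAr).
rewrite ?scalerA ?mulmxA.
apply/matrixP => i j; rewrite !(entryD, entryN, entryZ) ?h4E hE.
by field.
Qed.

(** Substituting [second_rhs] into [X1 *m D2] and [D2 *m Y1] cancels all cubic terms with [X1] on
    the left and [Y1] on the right, and merges the rest of them with [X1 *m X1 *m D] and
    [D *m (Y1 *m Y1)]. [G] survives only in a product with four further factors. *)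
Lemma DSbar_residual :
  (1%:M - X + h *: (X *m X)) *m (G + D) *m (1%:M + Y + h *: (Y *m Y))
    - (G + (S1 + S2)) =
  - (h *: (X2 *m P)) + h *: (P *m Y2) - h *: (X1 *m S2) + h *: (S2 *m Y1)
  + h4 *: (X1 *m X1 *m (D - S1)) + h4 *: ((D - S1) *m (Y1 *m Y1))
  + h *: (X2 *m (D2 - S2)) - h *: ((D2 - S2) *m Y2)
  - h *: (X2 *m P *m Y1 + X1 *m P *m Y2 + X2 *m P *m Y2)
  + h *: (X *m (D2 - S2) *m Y)
  + h *: ((X1 *m X2 + X2 *m X1 + X2 *m X2) *m D)
  + h *: (D *m (Y1 *m Y2 + Y2 *m Y1 + Y2 *m Y2))
  + h *: (X *m X *m D *m Y) - h *: (X *m D *m (Y *m Y))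
  + h4 *: (X *m X *m G *m (Y *m Y))
  + h4 *: (X *m X *m D *m (Y *m Y)).
Proof.
have commE : X *m G - G *m Y = D - S1 + (D2 - S2).
  rewrite -first_order -second_order mulmxDl mulmxDr.
  by apply/matrixP => i j; rewrite !(entryD, entryN); ring.
rewrite (mulmxDr _ G D) mulmxDl skew_expansion sandwich_expansion commE.
(* These four products occur identically on both sides and need no expansion. *)
move: (X *m X *m D *m Y) (X *m D *m (Y *m Y)) => Z1 Z2.
move: (X *m X *m D *m (Y *m Y)) (X *m X *m G *m (Y *m Y)) => Z3 Z4.
rewrite second_rhs.
(* Taking the sums as atoms and writing [X2 = X' - X1], [Y2 = Y' - Y1] avoids expanding powers of
   [X1 + X2] and [Y1 + Y2]. *)
set X' := X; set Y' := Y.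
have -> : X2 = X' - X1 by rewrite /X' addrC addKr.
have -> : Y2 = Y' - Y1 by rewrite /Y' addrC addKr.
clearbody X' Y'.
do 5 (rewrite ?mulmxDl ?mulmxDr ?scalerDr ?oppD).
rewrite ?mul1mx ?mulmx1.
do 3 (rewrite ?mulNmx ?mulmxN ?scalerN).
do 3 (rewrite ?scaleAl ?scaleAr).
rewrite ?scalerA ?mulmxA.
apply/matrixP => i j; rewrite !(entryD, entryN, entryZ) ?h4E hE.
by field.
Qed.
End ResidualIdentities.

(** * The matrix norm *)

Section MatrixNorm.
Set Implicit Arguments.
Unset Strict Implicit.
Variable R : realType.
Local Notation C := R[i].

Lemma normc_ge0 (z : C) : 0 <= Normc.normc z.
Proof. by case: z => a b; exact: sqrtr_ge0. Qed.

Lemma normc_conj (z : C) : Normc.normc (z^*) = Normc.normc z.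
Proof. by case: z => a b /=; rewrite sqrrN. Qed.

Lemma normc_real (x : R) : Normc.normc (x%:C)%C = `|x|.
Proof. by rewrite /= expr0n addr0 sqrtr_sqr. Qed.

Lemma normc_half (z : C) : Normc.normc (1 / 2 * z) = 1 / 2 * Normc.normc z.
Proof.
have -> : (1 / 2 : C) = ((1 / 2 : R)%:C)%C by rewrite fmorph_div rmorph1 rmorph_nat.
by rewrite Normc.normcM normc_real ger0_norm // divr_ge0.
Qed.

Lemma norm1_le m n (A : 'M[C]_(m, n)) c :
  0 <= c -> (forall i, \sum_j Normc.normc (A i j) <= c) -> norm1 A <= c.
Proof. by move=> c0 Ac; apply: bigmax_le => // i _; exact: Ac. Qed.

Lemma row_le_norm1 m n (A : 'M[C]_(m, n)) i :
  \sum_j Normc.normc (A i j) <= norm1 A.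
Proof. exact: (le_bigmax 0 (fun i => \sum_j Normc.normc (A i j))). Qed.

Lemma norm1_ge0 m n (A : 'M[C]_(m, n)) : 0 <= norm1 A.
Proof.
rewrite /norm1; elim/big_ind: _ => // [x y x0 _|i _]; first by rewrite le_max x0.
by apply: sumr_ge0 => j _; exact: normc_ge0.
Qed.

Lemma norm1N m n (A : 'M[C]_(m, n)) : norm1 (- A) = norm1 A.
Proof.
by apply: eq_bigr => i _; apply: eq_bigr => j _; rewrite mxE normcN.
Qed.

Lemma norm1D m n (A B : 'M[C]_(m, n)) : norm1 (A + B) <= norm1 A + norm1 B.
Proof.
apply: norm1_le => [|i]; first by rewrite addr_ge0 ?norm1_ge0.
apply: (le_trans _ (lerD (row_le_norm1 A i) (row_le_norm1 B i))).
by rewrite -big_split; apply: ler_sum => j _; rewrite mxE le_normcD.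
Qed.

Lemma norm1M m n p (A : 'M[C]_(m, n)) (B : 'M[C]_(n, p)) :
  norm1 (A *m B) <= norm1 A * norm1 B.
Proof.
apply: norm1_le => [|i]; first by rewrite mulr_ge0 ?norm1_ge0.
have entry j : Normc.normc ((A *m B) i j) <=
    \sum_k Normc.normc (A i k) * Normc.normc (B k j).
  rewrite mxE; elim/big_ind2: _ => [|x a y b xa yb|k _].
  - by rewrite Normc.normc0.
  - exact: le_trans (le_normcD _ _) (lerD xa yb).
  - by rewrite Normc.normcM.
apply: le_trans (ler_sum _ (fun j _ => entry j)) _.
rewrite exchange_big; apply: (le_trans _ (ler_wpM2r (norm1_ge0 _) (row_le_norm1 A i))).
rewrite mulr_suml; apply: ler_sum => k _; rewrite -mulr_sumr.
by rewrite ler_wpM2l ?normc_ge0 ?row_le_norm1.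
Qed.

Lemma ctrmxN m n (A : 'M[C]_(m, n)) : (- A) ^t* = - A ^t*.
Proof. by apply/matrixP => i j; rewrite !mxE rmorphN. Qed.

Lemma ctrmxD m n (A B : 'M[C]_(m, n)) : (A + B) ^t* = A ^t* + B ^t*.
Proof. by apply/matrixP => i j; rewrite !mxE rmorphD. Qed.

Lemma ctrmxM m n p (A : 'M[C]_(m, n)) (B : 'M[C]_(n, p)) :
  (A *m B) ^t* = B ^t* *m A ^t*.
Proof. by rewrite trmx_mul map_mxM. Qed.

Lemma ctrmx_half m n (A : 'M[C]_(m, n)) :
  ((1 / 2) *: A) ^t* = (1 / 2) *: A ^t*.
Proof.
by apply/matrixP => i j; rewrite !mxE rmorphM fmorph_div rmorph1 rmorph_nat.
Qed.

Lemma mxnorm_le m n (A : 'M[C]_(m, n)) c : 0 <= c ->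
  (forall i, \sum_j Normc.normc (A i j) <= c) ->
  (forall j, \sum_i Normc.normc (A i j) <= c) -> mxnorm A <= c.
Proof.
move=> c0 rowA colA; rewrite /mxnorm ge_max !norm1_le // => j.
by apply: le_trans _ (colA j); apply: ler_sum => i _; rewrite !mxE normc_conj.
Qed.

Lemma row_le_mxnorm m n (A : 'M[C]_(m, n)) i :
  \sum_j Normc.normc (A i j) <= mxnorm A.
Proof. by rewrite le_max row_le_norm1. Qed.

Lemma col_le_mxnorm m n (A : 'M[C]_(m, n)) j :
  \sum_i Normc.normc (A i j) <= mxnorm A.
Proof.
rewrite le_max orbC; apply/orP; left; apply: (le_trans _ (row_le_norm1 (A ^t*) j)).
by apply: ler_sum => i _; rewrite !mxE normc_conj.
Qed.

Lemma mxnorm_ge0 m n (A : 'M[C]_(m, n)) : 0 <= mxnorm A.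
Proof. by rewrite le_max norm1_ge0. Qed.

(** This and the following estimates take bounds as hypotheses, so that they chain along the
    structure of a matrix expression while unification builds the resulting bound. *)
Lemma mxnormN_le m n (A : 'M[C]_(m, n)) a : mxnorm A <= a -> mxnorm (- A) <= a.
Proof. by rewrite /mxnorm ctrmxN !norm1N. Qed.

Lemma mxnormD_le m n (A B : 'M[C]_(m, n)) a b :
  mxnorm A <= a -> mxnorm B <= b -> mxnorm (A + B) <= a + b.
Proof.
rewrite /mxnorm !ge_max => /andP[Aa Aa'] /andP[Bb Bb'].
by rewrite ctrmxD; apply/andP; split; apply: le_trans (norm1D _ _) _; rewrite lerD.
Qed.

Lemma mxnormM_le m n p (A : 'M[C]_(m, n)) (B : 'M[C]_(n, p)) a b :
  mxnorm A <= a -> mxnorm B <= b -> mxnorm (A *m B) <= a * b.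
Proof.
rewrite /mxnorm !ge_max => /andP[Aa Aa'] /andP[Bb Bb'].
rewrite ctrmxM; apply/andP; split; apply: le_trans (norm1M _ _) _.
  by rewrite ler_pM ?norm1_ge0.
by rewrite mulrC ler_pM ?norm1_ge0.
Qed.

Lemma mxnorm_half_le m n (A : 'M[C]_(m, n)) a :
  mxnorm A <= a -> mxnorm ((1 / 2) *: A) <= 1 / 2 * a.
Proof.
move=> Aa; apply: mxnorm_le => [|i|j].
- by rewrite mulr_ge0 ?divr_ge0 // (le_trans (mxnorm_ge0 A)).
- under eq_bigr do rewrite mxE normc_half.
  by rewrite -mulr_sumr ler_wpM2l ?divr_ge0 // (le_trans (row_le_mxnorm A i)).
- under eq_bigr do rewrite mxE normc_half.
  by rewrite -mulr_sumr ler_wpM2l ?divr_ge0 // (le_trans (col_le_mxnorm A j)).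
Qed.

Lemma mxnorm_quarter_le m n (A : 'M[C]_(m, n)) a :
  mxnorm A <= a -> mxnorm ((1 / 4) *: A) <= 1 / 4 * a.
Proof.
have -> : (1 / 4 : C) = 1 / 2 * (1 / 2) by field.
rewrite -scalerA => /mxnorm_half_le/mxnorm_half_le/le_trans; apply.
lra.
Qed.

End MatrixNorm.

(** * Condition numbers and canonical solutions *)

Section ConditionNumbers.
Set Implicit Arguments.
Unset Strict Implicit.
Variables (R : realType) (l q : nat) (hql : (q <= l)%N).
Local Notation C := R[i].
Variable Sigma : 'M[R]_(l, q).
Hypothesis diagSigma : diagonal_rect Sigma.
Local Notation s := (diag hql Sigma).
Hypothesis s_gt0 : forall i, 0 < s i.
Hypothesis s_inj : forall i j, i <> j -> s i <> s j.
Local Notation kap := (kappa hql Sigma).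
Local Notation K := (bigK hql Sigma).

Lemma kappa_ge1 : 1 <= kap.
Proof. by rewrite le_max lexx. Qed.

Lemma bigK_ge1 : 1 <= K.
Proof. by rewrite le_max lexx. Qed.

Lemma diag_le_bigK i : s i <= K.
Proof. by rewrite le_max (le_bigmax 0 s) orbT. Qed.

Lemma inv_diag_le_kappa i : (s i)^-1 <= kap.
Proof.
rewrite /kappa !le_max; apply/orP; right; apply/orP; left.
apply: le_trans _ (le_bigmax 0 (fun i => 1 / `|s i|) i).
by rewrite div1r gtr0_norm.
Qed.

Lemma inv_gap_le_kappa i j : i <> j ->
  `|s i - s j|^-1 + (s i + s j)^-1 <= kap.
Proof.
move=> /eqP ij; rewrite /kappa !le_max; apply/orP; right; apply/orP; right.
apply: le_trans _ (le_bigmax_cond 0 (fun p : 'I_q * 'I_q =>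
  1 / `|s p.1 - s p.2| + 1 / `|s p.1 + s p.2|) (_ : (i, j).1 != (i, j).2)) => //.
by rewrite !div1r /= [X in _ <= _ + X^-1]gtr0_norm ?addr_gt0.
Qed.

(* With [x = kappa s_j] and [y = kappa s_i >= 1] for [s_i < s_j], the gap
   condition reads [2 x <= x^2 - y^2], so [x >= 1 + sqrt 2]. *)
Lemma kappa_bigK_ge : (1 < q)%N -> 241 / 100 <= kap * K.
Proof.
move=> q1.
have [i [j sij]] : exists i j, s i < s j.
  pose i0 := Ordinal (ltnW q1); pose i1 := Ordinal q1.
  have : s i0 <> s i1 by apply: s_inj.
  by move/eqP; rewrite neq_lt => /orP[] ?; [exists i0, i1|exists i1, i0].
have k1 := kappa_ge1; have si := s_gt0 i.
have ik : 1 <= kap * s i by rewrite -ler_pdivrMr // div1r inv_diag_le_kappa.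
have ji : j <> i by move=> ji; rewrite ji ltxx in sij.
have := inv_gap_le_kappa ji; rewrite gtr0_norm ?subr_gt0 // => gap.
have {}gap : 2 * s j <= kap * ((s j - s i) * (s j + s i)).
  rewrite -ler_pdivrMr; last by rewrite mulr_gt0 ?subr_gt0 ?addr_gt0.
  suff <- : (s j - s i)^-1 + (s j + s i)^-1 = 2 * s j / ((s j - s i) * (s j + s i)) by [].
  by field; rewrite subr_eq0 !gt_eqF // addr_gt0.
apply: le_trans (_ : kap * s j <= _); last first.
  by rewrite ler_wpM2l ?diag_le_bigK // (le_trans ler01).
set x := kap * s j; have xy : kap * s i < x by rewrite ltr_pM2l // (lt_le_trans ltr01).
have {}gap : 2 * x <= x * x - (kap * s i) * (kap * s i).
  have -> : x * x - kap * s i * (kap * s i) = kap * (kap * ((s j - s i) * (s j + s i))).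
    by rewrite /x; ring.
  by rewrite /x mulrCA ler_wpM2l // (le_trans ler01).
move: ik xy gap; generalize (kap * s i) x; clear => y x y1 yx gap.
(* The constant [241 / 100] lies just below [1 + sqrt 2]: for [1 <= x < 241 / 100] one has
   [x * x - 2 * x < 1 <= y * y]. *)
by rewrite leNgt; apply/negP => x_lt; nra.
Qed.

(** Each row and each column of [Sigma] has at most one nonzero entry, so every row or column sum is
    a single [s j] or zero. *)
Lemma toC_le_bigK : mxnorm (toC Sigma) <= K.
Proof.
have K0 : 0 <= K := le_trans ler01 bigK_ge1.
have entry i (j : 'I_q) : i != widen_ord hql j -> Normc.normc (toC Sigma i j) = 0.
  by move=> ij; rewrite mxE diagSigma ?Normc.normc0.
have diag_entry (j : 'I_q) : Normc.normc (toC Sigma (widen_ord hql j) j) <= K.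
  by rewrite mxE normc_real gtr0_norm ?diag_le_bigK // s_gt0.
apply: mxnorm_le => // [i|j].
  case: (ltnP i q) => iq.
    have -> : i = widen_ord hql (Ordinal iq) by apply: val_inj.
    rewrite (bigD1 (Ordinal iq)) //= big1 ?addr0 // => j ji.
    by apply: entry; apply: contra ji => /eqP/(congr1 val)/= ij; apply/eqP/val_inj.
  rewrite big1 // => j _; apply: entry; apply: contraTneq iq => ->.
  by rewrite -ltnNge /=.
by rewrite (bigD1 (widen_ord hql j)) //= big1 ?addr0 // => i /entry.
Qed.
End ConditionNumbers.

(** * Canonical solutions: skew symmetry and the equation they solve *)

Section CanonicalEquation.
Set Implicit Arguments.
Unset Strict Implicit.
Variables (R : realType) (l q : nat) (hql : (q <= l)%N).
Local Notation C := R[i].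
Variable Sigma : 'M[R]_(l, q).
Hypothesis diagSigma : diagonal_rect Sigma.
Local Notation s := (diag hql Sigma).
Hypothesis s_gt0 : forall i, 0 < s i.
Hypothesis s_inj : forall i j, i <> j -> s i <> s j.
Local Notation kap := (kappa hql Sigma).
Local Notation K := (bigK hql Sigma).
Variable D : 'M[C]_(l, q).
Local Notation X := (canX hql Sigma D).
Local Notation Y := (canY hql Sigma D).
Local Notation S := (toC (canS D)).
Local Notation w := (widen_ord hql).

Lemma mxnorm_mono m n (A B : 'M[C]_(m, n)) :
  (forall i j, Normc.normc (A i j) <= Normc.normc (B i j)) ->
  mxnorm A <= mxnorm B.
Proof.
move=> AB; apply: mxnorm_le => [|i|j]; first exact: mxnorm_ge0.
  by apply: le_trans _ (row_le_mxnorm B i); apply: ler_sum.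
by apply: le_trans _ (col_le_mxnorm B j); apply: ler_sum.
Qed.

Lemma normc_Re (z : C) : `|complex.Re z| <= Normc.normc z.
Proof.
case: z => a b /=; rewrite -sqrtr_sqr ler_wsqrtr // lerDl; exact: sqr_ge0.
Qed.

Lemma normc_Im (z : C) : `|complex.Im z| <= Normc.normc z.
Proof.
case: z => a b /=; rewrite -sqrtr_sqr ler_wsqrtr // lerDr; exact: sqr_ge0.
Qed.

Lemma canS_le : mxnorm S <= mxnorm D.
Proof.
apply: mxnorm_mono => i j; rewrite !mxE normc_real; case: ifP => _.
  exact: normc_Re.
by rewrite normr0 normc_ge0.
Qed.

(** On the diagonal, removing the real part leaves the imaginary part, so the entries do not grow;
    the triangle inequality would cost a factor 2. *)
Lemma subr_canS_le : mxnorm (D - S) <= mxnorm D.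
Proof.
apply: mxnorm_mono => i j; rewrite !mxE; case: ifP => _; last by rewrite subr0.
case: (D i j) => a b /=; rewrite subrr oppr0 addr0 expr0n add0r.
by rewrite ler_wsqrtr // lerDr sqr_ge0.
Qed.

(** This case split follows the [match] that defines the blocks of [canX]. *)
Lemma widen_or_ge (i : 'I_l) :
  (exists2 i' : 'I_q, i = w i' & (insub (val i) : option 'I_q) = Some i') \/
  (q <= i)%N /\ (insub (val i) : option 'I_q) = None.
Proof.
case: (ltnP i q) => iq; last by right; rewrite insubN // -leqNgt.
by left; exists (Ordinal iq); [exact: val_inj|rewrite insubT].
Qed.

Lemma canX_ww i j : X (w i) (w j) = canX_square hql Sigma D i j.
Proof. by rewrite mxE /= !valK. Qed.

Lemma conj_can_diag i : (can_diag hql Sigma D i)^* = - can_diag hql Sigma D i.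
Proof. by apply/eqP; rewrite eq_complex /= oppr0 !eqxx. Qed.

Lemma canX_square_skew i j :
  (canX_square hql Sigma D j i)^* = - canX_square hql Sigma D i j.
Proof.
rewrite /canX_square; case: (ltngtP i j) => [ij|ji|/val_inj->].
- by rewrite gt_eqF // rmorphN /= conjCK.
- by rewrite (negPf (_ : i != j)) ?opprK //; apply: contraTneq ji => ->; rewrite ltnn.
- by rewrite eqxx conj_can_diag.
Qed.

Lemma canX_skew : X ^t* = - X.
Proof.
apply/matrixP => i j; rewrite !mxE.
case: (widen_or_ge i) => [[i' _ ->]|[_ ->]]; case: (widen_or_ge j) => [[j' _ ->]|[_ ->]].
- exact: canX_square_skew.
- by rewrite opprK.
- by rewrite rmorphN /= conjCK.
- by rewrite rmorph0 oppr0.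
Qed.

Lemma canY_skew : Y ^t* = - Y.
Proof.
apply/matrixP => i j; rewrite !mxE; case: (ltngtP i j) => [ij|ji|/val_inj->].
- by rewrite gt_eqF // rmorphN /= conjCK.
- by rewrite (negPf (_ : i != j)) ?opprK //; apply: contraTneq ji => ->; rewrite ltnn.
- by rewrite eqxx rmorphN /= conj_can_diag.
Qed.

Lemma mul_toC_diag m (A : 'M[C]_(m, l)) i j :
  (A *m toC Sigma) i j = A i (w j) * ((s j)%:C)%C.
Proof.
rewrite mxE (bigD1 (w j)) //= mxE big1 ?addr0 // => k kj.
by rewrite mxE diagSigma ?mulr0.
Qed.

Lemma mul_diag_toC m (A : 'M[C]_(q, m)) i j :
  (toC Sigma *m A) (w i) j = ((s i)%:C)%C * A i j.
Proof.
rewrite mxE (bigD1 i) //= mxE big1 ?addr0 // => k ki.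
by rewrite mxE diagSigma ?mul0r // eq_sym.
Qed.

Lemma mul_diag_toC_ge m (A : 'M[C]_(q, m)) (i : 'I_l) j :
  (q <= i)%N -> (toC Sigma *m A) i j = 0.
Proof.
move=> qi; rewrite mxE big1 // => k _.
by rewrite mxE diagSigma ?mul0r // gtn_eqF // (leq_trans (ltn_ord k)).
Qed.

(** For [i < j], let [u] and [v] be the sum and the difference of [d i j] and the conjugate of
    [d j i]. The denominators cancel in [x s_j - s_i y], leaving [(u + v) / 2 = d i j]. Below the
    diagonal the same computation holds after conjugation, and in the rows from [q] on [Sigma]
    vanishes. *)
Lemma canonicalE : X *m toC Sigma - toC Sigma *m Y + S = D.
Proof.
have real_conj (x : R) : ((x%:C)%C)^* = (x%:C)%C by exact: conjc_real.
have sC0 j : ((s j)%:C)%C != 0 by rewrite eq_complex /= gt_eqF.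
have sumC0 i j : ((s i)%:C)%C + ((s j)%:C)%C != 0.
  by rewrite -rmorphD eq_complex /= gt_eqF // addr_gt0.
have difC0 i j : i != j -> ((s i)%:C)%C - ((s j)%:C)%C != 0.
  move=> /eqP ij; rewrite -rmorphB eq_complex /= negb_and; apply/orP; left.
  by rewrite subr_eq0; apply/eqP; exact: s_inj.
have entryD (A B : 'M[C]_(l, q)) i j : (A + B) i j = A i j + B i j by rewrite mxE.
have entryN (A : 'M[C]_(l, q)) i j : (- A) i j = - A i j by rewrite mxE.
have entryS i j : S i j =
    (if i == j :> nat then ((complex.Re (D i j))%:C)%C else 0).
  by rewrite !mxE; case: ifP.
apply/matrixP => i j; rewrite !(entryD, entryN) entryS mul_toC_diag.
case: (widen_or_ge i) => [[i' -> _]|[qi iN]]; last first.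
  rewrite mul_diag_toC_ge // [X i _]mxE iN /= valK.
  rewrite gtn_eqF ?(leq_trans (ltn_ord j)) // subr0 addr0.
  by rewrite divfK.
rewrite mul_diag_toC canX_ww [Y _ _]mxE /canX_square /=.
case: (ltngtP i' j) => [ij|ji|/val_inj->].
- have ij' : j != i' by apply: contraTneq ij => ->; rewrite ltnn.
  rewrite /canX_upper /canY_upper rmorphB rmorphD /= addr0.
  by field; rewrite sumC0 difC0.
- have ij' : i' != j by apply: contraTneq ji => ->; rewrite ltnn.
  rewrite (negPf ij') /canX_upper /canY_upper /= addr0.
  do 8 rewrite ?(rmorphM, rmorphB, rmorphD, rmorphN, fmorphV, rmorph1)
    ?conjCK ?real_conj /=.
  by field; rewrite sumC0 difC0.
- rewrite eqxx /can_diag; case: (D (w j) j) => a b /=; have := s_gt0 j => sj.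
  apply/eqP; rewrite eq_complex /=; apply/andP; split; apply/eqP.
    by ring.
  by field; rewrite gt_eqF.
Qed.

End CanonicalEquation.

(** * Norm bounds for canonical solutions *)

Section CanonicalBounds.
Set Implicit Arguments.
Unset Strict Implicit.
Variables (R : realType) (l q : nat) (hql : (q <= l)%N).
Local Notation C := R[i].
Variable Sigma : 'M[R]_(l, q).
Hypothesis diagSigma : diagonal_rect Sigma.
Local Notation s := (diag hql Sigma).
Hypothesis s_gt0 : forall i, 0 < s i.
Hypothesis s_inj : forall i j, i <> j -> s i <> s j.
Local Notation kap := (kappa hql Sigma).
Local Notation K := (bigK hql Sigma).
Variable D : 'M[C]_(l, q).
Local Notation X := (canX hql Sigma D).
Local Notation Y := (canY hql Sigma D).
Local Notation S := (toC (canS D)).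
Local Notation w := (widen_ord hql).

Local Notation "`| z |c" := (Normc.normc z) (format "`| z |c").

Lemma kappa_ge0 : 0 <= kap.
Proof. exact: le_trans ler01 (kappa_ge1 _ _). Qed.

(** For a skew Hermitian matrix row sums and column sums agree, so the rows suffice. *)
Lemma mxnorm_skew_le m (A : 'M[C]_m) c : A ^t* = - A -> 0 <= c ->
  (forall i, \sum_j `|A i j|c <= c) -> mxnorm A <= c.
Proof. by move=> skA c0 Ac; rewrite /mxnorm skA norm1N maxxx; exact: norm1_le. Qed.

Lemma sum_widen_le (f : 'I_l -> R) :
  (forall k, 0 <= f k) -> \sum_(j < q) f (w j) <= \sum_(k < l) f k.
Proof.
move=> f0; rewrite -(big_ord_narrow (F := f) hql) big_mkcond.
by apply: ler_sum => k _; case: ifP.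
Qed.

(** Factoring out the larger modulus leaves exactly the sum of two reciprocals that occurs in
    [kappa]. *)
Lemma half_fractions_le (x y : C) (i j : 'I_q) : i <> j ->
  1 / 2 * (`|x|c / `|s i - s j| + `|y|c / (s i + s j))
    <= kap / 2 * Num.max `|x|c `|y|c.
Proof.
move=> ij; have gap := inv_gap_le_kappa s_gt0 ij.
have x0 := normc_ge0 x; have y0 := normc_ge0 y.
have u0 : 0 <= `|s i - s j|^-1 by rewrite invr_ge0.
have v0 : 0 <= (s i + s j)^-1 by rewrite invr_ge0 addr_ge0 // ltW.
have := lerD (ler_wpM2r u0 (_ : `|x|c <= Num.max `|x|c `|y|c))
  (ler_wpM2r v0 (_ : `|y|c <= Num.max `|x|c `|y|c)).
rewrite !le_max !lexx orbT => /(_ isT isT) le1.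
have := ler_wpM2l (_ : 0 <= Num.max `|x|c `|y|c) gap; rewrite le_max x0 => /(_ isT).
move: le1; rewrite -mulrDr; lra.
Qed.

(** The sign [e] treats [canX_upper] ([e = 1]) and [canY_upper] ([e = -1]) together. *)
Let offdiag_bound i j (e : C) : i <> j ->
  e = 1 \/ e = -1 ->
  `|1 / 2 * ((D (w i) j + (D (w j) i)^*) / (s j - s i)%:C%C
      + e * ((D (w i) j - (D (w j) i)^*) / (s j + s i)%:C%C))|c
    <= kap / 2 * (`|D (w i) j|c + `|D (w j) i|c).
Proof.
move=> ij e1; have ji : j <> i by move=> /esym.
have e1c : `|e|c = 1 by case: e1 => ->; rewrite ?normcN Normc.normc1.
rewrite normc_half; set x := D (w i) j + _; set y := D (w i) j - _.
apply: le_trans (_ : 1 / 2 * (`|x|c / `|s j - s i| + `|y|c / (s j + s i)) <= _).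
  rewrite ler_wpM2l ?divr_ge0 //; apply: le_trans (le_normcD _ _) _.
  rewrite !Normc.normcM e1c mul1r !Normc.normcV !normc_real.
  by rewrite [`|s j + s i|]gtr0_norm ?addr_gt0.
apply: le_trans (half_fractions_le x y ji) _.
rewrite ler_wpM2l ?divr_ge0 ?kappa_ge0 // ge_max /x /y.
by rewrite !(le_trans (le_normcD _ _)) ?normcN ?normc_conj.
Qed.

Lemma can_diag_le i : `|can_diag hql Sigma D i|c <= kap / 2 * `|D (w i) i|c.
Proof.
rewrite /= expr0n add0r sqrtr_sqr normrM.
rewrite [`|(2 * _)^-1|]gtr0_norm ?invr_gt0 ?mulr_gt0 //.
have := ler_pM (normr_ge0 _) (_ : 0 <= (s i)^-1) (normc_Im (D (w i) i))
  (inv_diag_le_kappa s_gt0 i).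
rewrite invr_ge0 ltW // => /(_ isT) le1.
by rewrite invfM; lra.
Qed.

Lemma canX_square_le i j : `|canX_square hql Sigma D i j|c <=
  kap / 2 * (`|D (w i) j|c + `|D (w j) i|c).
Proof.
have upper i' j' : i' <> j' -> `|canX_upper hql Sigma D i' j'|c <=
    kap / 2 * (`|D (w i') j'|c + `|D (w j') i'|c).
  move=> ij; have := offdiag_bound ij (or_introl (erefl 1)).
  by rewrite [1 * ((_ - _) / _)]mul1r.
rewrite /canX_square; case: ifP => [ij|_].
  by apply: upper => ij'; rewrite ij' ltnn in ij.
case: eqP => [->|/nesym ij]; last by rewrite normcN normc_conj [X in _ * X]addrC upper.
apply: le_trans (can_diag_le j) _.
by rewrite ler_wpM2l ?divr_ge0 ?kappa_ge0 // lerDl normc_ge0.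
Qed.

Lemma canY_entry_le i j : `|Y i j|c <= kap / 2 * (`|D (w i) j|c + `|D (w j) i|c).
Proof.
have upper i' j' : i' <> j' -> `|canY_upper hql Sigma D i' j'|c <=
    kap / 2 * (`|D (w i') j'|c + `|D (w j') i'|c).
  by move=> ij; have := offdiag_bound ij (or_intror (erefl (-1))); rewrite mulN1r.
rewrite mxE; case: ifP => [ij|_].
  by apply: upper => ij'; rewrite ij' ltnn in ij.
case: eqP => [->|/nesym ij]; last by rewrite normcN normc_conj [X in _ * X]addrC upper.
rewrite normcN; apply: le_trans (can_diag_le j) _.
by rewrite ler_wpM2l ?divr_ge0 ?kappa_ge0 // lerDl normc_ge0.
Qed.

(** Row [i] of [Y] is controlled by half of row [i] plus half of column [i] of [D]; [mxnorm] bounds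
    both. *)
Lemma canY_le : mxnorm Y <= kap * mxnorm D.
Proof.
apply: mxnorm_skew_le => [||i]; first exact: canY_skew.
  by rewrite mulr_ge0 ?kappa_ge0 ?mxnorm_ge0.
apply: le_trans (ler_sum _ (fun j _ => canY_entry_le i j)) _.
rewrite -mulr_sumr big_split /=.
rewrite [leRHS](_ : _ = kap / 2 * (mxnorm D + mxnorm D)); last by field.
rewrite ler_wpM2l ?divr_ge0 ?kappa_ge0 // lerD ?row_le_mxnorm //.
apply: le_trans _ (col_le_mxnorm D i).
by apply: (sum_widen_le (f := fun k => `|D k i|c)) => k; exact: normc_ge0.
Qed.

Let ord_singleton (i j : 'I_q) : q = 1%N -> i = j.
Proof.
move=> q1; have val0 (k : 'I_q) : k = 0%N :> nat.
  by apply/eqP; rewrite -leqn0 -ltnS -q1.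
by apply: val_inj; rewrite /= !val0.
Qed.

(** [Y] is then a single diagonal entry, whose bound carries the factor [kappa / 2]. *)
Lemma canY_le_q1 : q = 1%N -> mxnorm Y <= 1 / 2 * (kap * mxnorm D).
Proof.
move=> q1; have K0 := kappa_ge0; have D0 := mxnorm_ge0 D.
apply: mxnorm_skew_le => [||i]; first exact: canY_skew.
  by rewrite (mulr_ge0 _ (mulr_ge0 _ _)) ?divr_ge0.
have only j : j = i by apply: ord_singleton.
rewrite (bigD1 i) //= big1 => [|j /eqP/(_ (only j))//]; rewrite addr0.
rewrite mxE ltnn eqxx normcN; apply: le_trans (can_diag_le i) _.
have := ler_wpM2l K0 (le_trans (_ : `|D (w i) i|c <= _) (row_le_mxnorm D (w i))).
rewrite (bigD1 i) //= lerDl sumr_ge0 => [/(_ isT) ?|? _]; last exact: normc_ge0.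
lra.
Qed.

(** The square block is bounded as for [Y]; the remaining columns repeat the lower part of column
    [i] of [D], divided by [s i], hence with full weight [kappa]. *)
Let canX_row_lt i : \sum_j `|X (w i) j|c <=
  kap / 2 * (\sum_(j < q) `|D (w i) j|c + \sum_(j < q) `|D (w j) i|c)
  + kap * \sum_(j < l | ~~ (j < q)%N) `|D j i|c.
Proof.
rewrite (bigID (fun j : 'I_l => (j < q)%N)) /=; apply: lerD.
  rewrite (big_ord_narrow (F := fun j => `|X (w i) j|c) hql) /=.
  rewrite -big_split mulr_sumr; apply: ler_sum => j _.
  by rewrite canX_ww canX_square_le.
rewrite mulr_sumr; apply: ler_sum => j jq; rewrite mxE /= valK insubN //.
rewrite normcN normc_conj Normc.normcM Normc.normcV normc_real gtr0_norm //.
by rewrite mulrC ler_wpM2r ?normc_ge0 ?inv_diag_le_kappa.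
Qed.

Let canX_row_ge (i : 'I_l) : (q <= i)%N -> \sum_j `|X i j|c <= kap * mxnorm D.
Proof.
move=> qi; rewrite (bigID (fun j : 'I_l => (j < q)%N)) /= [X in _ + X]big1 ?addr0.
  rewrite (big_ord_narrow (F := fun j => `|X i j|c) hql) /=.
  apply: le_trans _ (ler_wpM2l kappa_ge0 (row_le_mxnorm D i)).
  rewrite mulr_sumr; apply: ler_sum => j _; rewrite mxE /= valK insubN -?leqNgt //.
  rewrite Normc.normcM Normc.normcV normc_real gtr0_norm //.
  by rewrite mulrC ler_wpM2r ?normc_ge0 ?inv_diag_le_kappa.
by move=> j jq; rewrite mxE !insubN -?leqNgt ?Normc.normc0 // leqNgt.
Qed.

Let col_split i : \sum_(j < q) `|D (w j) i|c
  + \sum_(j < l | ~~ (j < q)%N) `|D j i|c <= mxnorm D.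
Proof.
apply: le_trans _ (col_le_mxnorm D i).
rewrite [leRHS](bigID (fun j : 'I_l => (j < q)%N)) /=.
by rewrite (big_ord_narrow (F := fun j => `|D j i|c) hql).
Qed.

(* The factor [3 / 2] cannot be lowered to [1] when [2 <= q < l]: the off-diagonal
   block of [X] contributes its own [kappa ||D||] to the first [q] rows. *)
Lemma canX_le : mxnorm X <= 3 / 2 * (kap * mxnorm D).
Proof.
have K0 := kappa_ge0; have KD0 := mulr_ge0 K0 (mxnorm_ge0 D).
apply: mxnorm_skew_le => [||i]; first exact: canX_skew.
  by rewrite mulr_ge0 ?divr_ge0.
case: (widen_or_ge hql i) => [[i' -> _]|[qi _]]; last by have := canX_row_ge qi; lra.
have := canX_row_lt i'; have := ler_wpM2l K0 (row_le_mxnorm D (w i')).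
have := ler_wpM2l K0 (col_split i').
have : 0 <= kap * \sum_(j < q) `|D (w j) i'|c.
  by rewrite mulr_ge0 // sumr_ge0 // => ? _; exact: normc_ge0.
lra.
Qed.

(** With one column the two sums over ['I_q] in [canX_row_lt] coincide, so the bound becomes [kappa]
    times a full column sum of [D]. *)
Lemma canX_le_q1 : q = 1%N -> mxnorm X <= kap * mxnorm D.
Proof.
move=> q1; have K0 := kappa_ge0; have KD0 := mulr_ge0 K0 (mxnorm_ge0 D).
apply: mxnorm_skew_le => [||i] //; first exact: canX_skew.
case: (widen_or_ge hql i) => [[i' -> _]|[qi _]]; last exact: canX_row_ge.
have only j : j = i' by apply: ord_singleton.
have := canX_row_lt i'; have := ler_wpM2l K0 (col_split i').
have -> : \sum_(j < q) `|D (w i') j|c = \sum_(j < q) `|D (w j) i'|c.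
  by apply: eq_bigr => j _; rewrite (only j).
lra.
Qed.

End CanonicalBounds.

(** * Numerical estimates *)

Section ScalingFactor.
Set Implicit Arguments.
Unset Strict Implicit.
Variables (R : realType) (k K : R).
Hypotheses (k1 : 1 <= k) (K1 : 1 <= K).
Let k0 : 0 <= k := le_trans ler01 k1.
Let K0 : 0 <= K := le_trans ler01 K1.

(** Raising to the power [n] clears the fractional exponents; the comparisons below are then made
    between powers with natural exponents. *)
Lemma powR_prodX (a b c : R) (n u v : nat) : a * n%:R = u%:R -> b * n%:R = v%:R ->
  c = k `^ a * K `^ b -> c ^+ n = k ^+ u * K ^+ v.
Proof.
move=> au bv ->; rewrite exprMn -!powR_mulrn ?powR_ge0 // -!powRrM au bv.
by rewrite !powR_mulrn.
Qed.

Lemma ler_of_pow (x y : R) n : 0 <= x -> 0 <= y -> x ^+ n.+1 <= y ^+ n.+1 -> x <= y.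
Proof. by move=> x0 y0; rewrite ler_pXn2r // nnegrE. Qed.

Let kK_ge1 u v : 1 <= k ^+ u * K ^+ v.
Proof. by rewrite mulr_ege1 ?exprn_ege1. Qed.

(** The monomial is [(k * K) ^+ n] times a power of [k], which is at least 1. *)
Let gap_pow y n u : 241 / 100 <= k * K -> 0 <= y ->
  1 <= y * (241 / 100) ^+ n -> 1 <= y * (k ^+ (n + u) * K ^+ n).
Proof.
move=> kK y0 y1; rewrite exprD [_ * K ^+ n]mulrAC -exprMn mulrA.
have pow_le : (241 / 100) ^+ n <= (k * K) ^+ n.
  by apply: lerXn2r => //; rewrite nnegrE; lra.
by rewrite mulr_ege1 ?exprn_ege1 // (le_trans y1) // ler_wpM2l.
Qed.

Section DS.
Let c := k `^ (5 / 4) * K `^ (2 / 5).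
Let cE : c ^+ 20 = k ^+ 25 * K ^+ 8.
Proof. by apply: powR_prodX erefl; lra. Qed.
Let c0 : 0 <= c. Proof. by rewrite mulr_ge0 ?powR_ge0. Qed.

(** Here [c ^+ 60 = k ^+ 75 * K ^+ 24], and [k ^+ u * K ^+ v] is what remains of it after dividing
    by [x ^+ 20]; [m] may be small as long as this remainder compensates. *)
Let le_c3 (x : R) u v m : 0 <= x -> 0 <= m ->
  x ^+ 20 * (k ^+ u * K ^+ v) = k ^+ 75 * K ^+ 24 ->
  1 <= m ^+ 20 * (k ^+ u * K ^+ v) -> x <= m * c ^+ 3.
Proof.
move=> x0 m0 xE me1; apply: (@ler_of_pow _ _ 19) => //.
  by rewrite mulr_ge0 ?exprn_ge0.
rewrite exprMn -exprM mulnC exprM cE exprMn -!exprM -xE mulrCA.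
by rewrite ler_peMr ?exprn_ge0.
Qed.

Lemma DS_scale_ge : k <= c.
Proof.
apply: (@ler_of_pow _ _ 19) => //; rewrite cE -[25%N]/(20 + 5)%N exprD -mulrA.
by rewrite ler_peMr ?exprn_ge0.
Qed.

Lemma DS_scale_sqr : k ^+ 2 <= c ^+ 3.
Proof.
rewrite -[leRHS]mul1r; apply: (@le_c3 _ 35 24) => //; first by rewrite exprn_ge0.
  by rewrite mulrA -exprM -exprD.
by rewrite expr1n mul1r.
Qed.

Lemma DS_scale_cube : K * k ^+ 3 <= c ^+ 3.
Proof.
rewrite -[leRHS]mul1r; apply: (@le_c3 _ 15 4) => //.
- by rewrite mulr_ge0 ?exprn_ge0.
- by rewrite exprMn -exprM [k ^+ 15 * _]mulrC mulrACA -!exprD mulrC.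
- by rewrite expr1n mul1r.
Qed.

Hypothesis kK : 241 / 100 <= k * K.

Lemma DS_scale_sqr_gap : k ^+ 2 <= 35 / 100 * c ^+ 3.
Proof.
apply: (@le_c3 _ 35 24); first by rewrite exprn_ge0.
- by rewrite divr_ge0.
- by rewrite mulrA -exprM -exprD.
(* [35 / 100] rounds up [241 / 100] to the power [- 24 / 20]. *)
apply: (@gap_pow _ 24 11 kK); first by rewrite exprn_ge0 ?divr_ge0.
by lra.
Qed.

Lemma DS_scale_cube_gap : K * k ^+ 3 <= 84 / 100 * c ^+ 3.
Proof.
apply: (@le_c3 _ 15 4).
- by rewrite mulr_ge0 ?exprn_ge0.
- by rewrite divr_ge0.
- by rewrite exprMn -exprM [k ^+ 15 * _]mulrC mulrACA -!exprD mulrC.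
(* [84 / 100] rounds up [241 / 100] to the power [- 4 / 20]. *)
apply: (@gap_pow _ 4 11 kK); first by rewrite exprn_ge0 ?divr_ge0.
by lra.
Qed.
End DS.

Section DSbar.
Let c := k `^ (6 / 5) * K `^ (3 / 10).
Let cE : c ^+ 10 = k ^+ 12 * K ^+ 3.
Proof. by apply: powR_prodX erefl; lra. Qed.
Let c0 : 0 <= c. Proof. by rewrite mulr_ge0 ?powR_ge0. Qed.

Lemma DSbar_scale_ge : k <= c.
Proof.
apply: (@ler_of_pow _ _ 9) => //; rewrite cE -[12%N]/(10 + 2)%N exprD -mulrA.
by rewrite ler_peMr ?exprn_ge0.
Qed.

(** [K] enters the second residual only at order four, which allows the smaller exponents:
    [c ^+ 40 = k ^+ 48 * K ^+ 12] dominates [k ^+ 40 * K ^+ 10]. *)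
Lemma DSbar_scale_fourth : K * k ^+ 4 <= c ^+ 4.
Proof.
apply: (@ler_of_pow _ _ 9).
- by rewrite mulr_ge0 ?exprn_ge0.
- by rewrite exprn_ge0.
rewrite [(K * _) ^+ 10]exprMn [(c ^+ 4) ^+ 10]exprAC cE.
rewrite [(_ * _) ^+ 4]exprMn -!exprM mulrC.
rewrite -[(12 * 4)%N]/(40 + 8)%N -[(3 * 4)%N]/(10 + 2)%N !exprD mulrACA.
by rewrite ler_peMr ?mulr_ge0 ?exprn_ge0.
Qed.

Let le_c3 m : 0 <= m -> 1 <= m ^+ 10 * (k ^+ 16 * K ^+ 9) -> k ^+ 2 <= m * c ^+ 3.
Proof.
move=> m0 me1; apply: (@ler_of_pow _ _ 9).
- by rewrite exprn_ge0.
- by rewrite mulr_ge0 ?exprn_ge0.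
rewrite [(m * _) ^+ 10]exprMn [(c ^+ 3) ^+ 10]exprAC cE [(_ * _) ^+ 3]exprMn -!exprM.
rewrite -[(12 * 3)%N]/(20 + 16)%N exprD -[k ^+ 20 * _ * _]mulrA mulrCA.
by rewrite ler_peMr ?exprn_ge0.
Qed.

Lemma DSbar_scale_sqr : k ^+ 2 <= c ^+ 3.
Proof. by rewrite -[leRHS]mul1r; apply: le_c3 => //; rewrite expr1n mul1r. Qed.

Lemma DSbar_scale_sqr_gap : 241 / 100 <= k * K -> k ^+ 2 <= 46 / 100 * c ^+ 3.
Proof.
move=> kK; apply: le_c3; first by rewrite divr_ge0.
(* [46 / 100] rounds up [241 / 100] to the power [- 9 / 10]. *)
apply: (@gap_pow _ 9 7 kK); first by rewrite exprn_ge0 ?divr_ge0.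
by lra.
Qed.
End DSbar.
End ScalingFactor.

(** * From residual polynomials to the stated constants *)

Section NumericBounds.
Set Implicit Arguments.
Unset Strict Implicit.
Variable R : realFieldType.

(* To be read with [||X|| <= a kappa ||D||], [||Y|| <= b kappa ||D||],
   [e = kappa eps1] and [p = kappa^2 eps1^3]; [g] is [K kappa^3 eps1^3] in
   [DS_bound] and [K kappa^4 eps1^4] in [DSbar_bound]. *)
Definition DS_bound (a b p g e : R) : R :=
  p * ((a + b) ^+ 2 + b * (a + b) + a ^+ 2 / 2 + b ^+ 2 / 2
    + (5 / 2 * a * b * (a + b)) * e
    + (3 / 2 * a * b * (a + b) ^+ 2 + a ^+ 2 * b ^+ 2 / 4) * e ^+ 2)
  + g * (2 * b ^+ 2 * (a + b)
    + (3 / 2 * a * b * (a + b) ^+ 2 + a ^+ 2 * b ^+ 2 / 4) * e).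

(** The factor [t] comes from bounding [X1 + X2] by [a * e * t] and [Y1 + Y2] by [b * e * t]. *)
Definition DSbar_bound (a b p g e : R) : R :=
  let t := 1 + (a + b) * e in
  p * (3 / 2 * (a + b) ^+ 2 + a ^+ 2 / 4 + b ^+ 2 / 4
    + ((a + b) ^+ 3 / 2 + 2 * a * b * (a + b) + a * b * (a + b) / 2 * t ^+ 2
       + (a ^+ 2 + b ^+ 2) * (a + b) + a * b * (a + b) / 2 * t ^+ 3) * e
    + (a * b * (a + b) ^+ 2 + (a ^+ 2 + b ^+ 2) / 2 * (a + b) ^+ 2
       + a ^+ 2 * b ^+ 2 / 4 * t ^+ 4) * e ^+ 2)
  + g * (a ^+ 2 * b ^+ 2 / 4 * t ^+ 4).

(** Indices give the order in [eps] when [p] and [g] count as cubic; primed coefficients are rounded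
    upper bounds. [A3] stays exact. *)
Lemma polynomial_le (p g e eps mu nu A3 A4 A5 B3 B4 A4' A5' B3' B4' : R) :
  0 <= p -> p <= mu * eps ^+ 3 -> 0 <= g -> g <= nu * eps ^+ 3 ->
  0 <= e -> e <= eps -> 0 <= A3 -> 0 <= A4 <= A4' -> 0 <= A5 <= A5' ->
  0 <= B3 <= B3' -> 0 <= B4 <= B4' ->
  p * (A3 + A4 * e + A5 * e ^+ 2) + g * (B3 + B4 * e) <=
  (mu * (A3 + A4' * eps + A5' * eps ^+ 2) + nu * (B3' + B4' * eps)) * eps ^+ 3.
Proof.
move=> p0 pe g0 ge e0 ee A30 /andP[A40 A4l] /andP[A50 A5l] /andP[B30 B3l] /andP[B40 B4l].
have eps0 := le_trans e0 ee.
have e2 : e ^+ 2 <= eps ^+ 2 by rewrite lerXn2r.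
have A4e := ler_pM A40 e0 A4l ee; have B4e := ler_pM B40 e0 B4l ee.
have A5e := ler_pM A50 (exprn_ge0 2 e0) A5l e2.
have := ler_pM p0 (_ : 0 <= A3 + A4 * e + A5 * e ^+ 2) pe
  (lerD (lerD (lexx A3) A4e) A5e).
have := ler_pM g0 (_ : 0 <= B3 + B4 * e) ge (lerD B3l B4e).
rewrite !addr_ge0 ?mulr_ge0 ?exprn_ge0 // => /(_ isT) le1 /(_ isT) le2.
by apply: le_trans (lerD le2 le1) _; rewrite le_eqVlt; apply/orP; left; apply/eqP; ring.
Qed.

Variables (p g e eps : R).
Hypotheses (p0 : 0 <= p) (g0 : 0 <= g) (e0 : 0 <= e) (ee : e <= eps).
Hypothesis eps_le : eps <= 1 / 10.

Let eps0 : 0 <= eps := le_trans e0 ee.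

Let final_le (B x : R) : B <= x * eps ^+ 3 ->
  forall y, x <= y -> B <= y * eps ^+ 3.
Proof. by move=> /le_trans Bx y xy; apply: Bx; rewrite ler_wpM2r ?exprn_ge0. Qed.

Lemma DS_numeric :
  p <= 35 / 100 * eps ^+ 3 -> g <= 84 / 100 * eps ^+ 3 ->
  DS_bound (3 / 2) 1 p g e <= (8 + 18 * eps + 33 * eps ^+ 2) * eps ^+ 3.
Proof.
move=> pe ge; have eps_ge0 := eps0; have eps2 := exprn_ge0 2 eps0.
(* The exact coefficients are [A3 = 10.375], [A4 = 9.375], [B3 = 5] and [A5 = B4 = 14.625]; the
   leading one becomes [0.35 * 10.375 + 0.84 * 5 < 8]. *)
apply: final_le (polynomial_le (A4' := 94 / 10) (A5' := 15) (B3' := 5)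
  (B4' := 15) p0 pe g0 ge e0 ee _ _ _ _ _) _ _; lra.
Qed.

Lemma DS_numeric_q1 : p <= eps ^+ 3 -> g <= eps ^+ 3 ->
  DS_bound 1 (1 / 2) p g e <= (8 + 18 * eps + 33 * eps ^+ 2) * eps ^+ 3.
Proof.
move=> pe ge; rewrite -[leRHS]mul1r in pe; rewrite -[leRHS]mul1r in ge.
have eps_ge0 := eps0; have eps2 := exprn_ge0 2 eps0.
apply: final_le (polynomial_le (A4' := 2) (A5' := 2) (B3' := 1)
  (B4' := 2) p0 pe g0 ge e0 ee _ _ _ _ _) _ _; lra.
Qed.

(** This is where [eps <= 1 / 10] enters: [s * e <= 1 / 4]. *)
Let t_pow (s : R) k : 0 <= s <= 5 / 2 -> 0 <= (1 + s * e) ^+ k <= (5 / 4) ^+ k.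
Proof.
move=> /andP[s0 s1]; have se0 := mulr_ge0 s0 e0.
have se : s * e <= 5 / 2 * (1 / 10) by rewrite ler_pM // (le_trans ee).
by rewrite exprn_ge0 ?addr_ge0 // lerXn2r // ?nnegrE; lra.
Qed.

Let addr_mul0 (x : R) : x = x + 0 * e. Proof. by rewrite mul0r addr0. Qed.

Lemma DSbar_numeric : p <= 46 / 100 * eps ^+ 3 -> g <= eps ^+ 4 ->
  DSbar_bound (3 / 2) 1 p g e <= (6 + 21 * eps + 54 * eps ^+ 2) * eps ^+ 3.
Proof.
(* Reading [eps ^+ 4] as [eps * eps ^+ 3] makes [polynomial_le] apply with [nu = eps], so the [g]
   part does not touch the leading coefficient. *)
move=> pe ge; rewrite [eps ^+ 4]exprS in ge.
have eps_ge0 := eps0; have eps2 := exprn_ge0 2 eps0.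
have s_le : 0 <= (3 / 2 + 1 : R) <= 5 / 2 by apply/andP; split; lra.
rewrite /DSbar_bound; move: (t_pow 2 s_le) (t_pow 3 s_le) (t_pow 4 s_le).
(* As independent bounded variables, the powers of [t] enter the coefficients linearly, within reach
   of [lra]. *)
set t := 1 + _; generalize (t ^+ 2) (t ^+ 3) (t ^+ 4) => t2 t3 t4.
move=> /andP[t2_ge0 t2_le] /andP[t3_ge0 t3_le] /andP[t4_ge0 t4_le].
rewrite [X in _ + _ * X]addr_mul0.
apply: final_le (polynomial_le (A4' := 31) (A5' := 21) (B3' := 14 / 10)
  (B4' := 0) p0 pe g0 ge e0 ee _ _ _ _ _) _ _; lra.
Qed.

Lemma DSbar_numeric_q1 : p <= eps ^+ 3 -> g <= eps ^+ 4 ->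
  DSbar_bound 1 (1 / 2) p g e <= (6 + 21 * eps + 54 * eps ^+ 2) * eps ^+ 3.
Proof.
move=> pe ge; rewrite -[leRHS]mul1r in pe; rewrite [eps ^+ 4]exprS in ge.
have eps_ge0 := eps0; have eps2 := exprn_ge0 2 eps0.
have s_le : 0 <= (1 + 1 / 2 : R) <= 5 / 2 by apply/andP; split; lra.
rewrite /DSbar_bound; move: (t_pow 2 s_le) (t_pow 3 s_le) (t_pow 4 s_le).
set t := 1 + _; generalize (t ^+ 2) (t ^+ 3) (t ^+ 4) => t2 t3 t4.
move=> /andP[t2_ge0 t2_le] /andP[t3_ge0 t3_le] /andP[t4_ge0 t4_le].
rewrite [X in _ + _ * X]addr_mul0.
apply: final_le (polynomial_le (A4' := 8) (A5' := 4) (B3' := 1)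
  (B4' := 0) p0 pe g0 ge e0 ee _ _ _ _ _) _ _; lra.
Qed.
End NumericBounds.

(** * The residual after one step *)

Section ResidualBounds.
Set Implicit Arguments.
Unset Strict Implicit.
Variables (R : realType) (l q : nat).
Local Notation C := R[i].
Variables (X1 X2 : 'M[C]_l) (Y1 Y2 : 'M[C]_q) (G D S1 S2 D2 : 'M[C]_(l, q)).
Local Notation h := (1 / 2 : C).
Local Notation h4 := (1 / 4 : C).
Local Notation P := (D + S1).
Hypothesis first_order : X1 *m G - G *m Y1 + S1 = D.
Hypothesis second_order : X2 *m G - G *m Y2 + S2 = D2.
Hypothesis second_rhs : D2 = - (h *: (X1 *m P)) + h *: (P *m Y1).
Variables a b kap K w : R.
Local Notation s := (a + b).
Local Notation e := (kap * w).
Hypothesis X1_le : mxnorm X1 <= a * e.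
Hypothesis Y1_le : mxnorm Y1 <= b * e.
Hypothesis X2_le : mxnorm X2 <= a * s * e ^+ 2.
Hypothesis Y2_le : mxnorm Y2 <= b * s * e ^+ 2.
Hypothesis G_le : mxnorm G <= K.
Hypothesis D_le : mxnorm D <= w.
Hypothesis S1_le : mxnorm S1 <= w.
Hypothesis S2_le : mxnorm S2 <= s * (kap * w ^+ 2).
Hypothesis DS1_le : mxnorm (D - S1) <= w.
Hypothesis DS2_le : mxnorm (D2 - S2) <= s * (kap * w ^+ 2).

(** The two differences come before the case of sums, so that [D - S1] and [D2 - S2] are bounded as
    a whole. *)
Ltac norm_bound := repeat lazymatch goal with
  | |- is_true (mxnorm (D - S1)%R <= _) => exact: DS1_le
  | |- is_true (mxnorm (D2 - S2)%R <= _) => exact: DS2_le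
  | |- is_true (mxnorm (- _)%R <= _) => eapply mxnormN_le
  | |- is_true (mxnorm (_ + _)%R <= _) => eapply mxnormD_le
  | |- is_true (mxnorm (_ *m _) <= _) => eapply mxnormM_le
  | |- is_true (mxnorm (h4 *: _) <= _) => eapply mxnorm_quarter_le
  | |- is_true (mxnorm (_ *: _) <= _) => eapply mxnorm_half_le
  | |- is_true (mxnorm X1 <= _) => exact: X1_le
  | |- is_true (mxnorm X2 <= _) => exact: X2_le
  | |- is_true (mxnorm Y1 <= _) => exact: Y1_le
  | |- is_true (mxnorm Y2 <= _) => exact: Y2_le
  | |- is_true (mxnorm G <= _) => exact: G_le
  | |- is_true (mxnorm D <= _) => exact: D_le
  | |- is_true (mxnorm S1 <= _) => exact: S1_le
  | |- is_true (mxnorm S2 <= _) => exact: S2_le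
  end.

(** [DS_bound] is exactly the sum of the bounds of the individual terms of [DS_residual]. *)
Lemma DS_residual_le :
  mxnorm ((1%:M - (X1 + X2) + h *: (X1 *m X1)) *m (G + D)
    *m (1%:M + (Y1 + Y2) + h *: (Y1 *m Y1)) - (G + (S1 + S2))) <=
  DS_bound a b (kap ^+ 2 * w ^+ 3) (K * kap ^+ 3 * w ^+ 3) e.
Proof.
rewrite (DS_residual (erefl h) (erefl h4) first_order second_order second_rhs).
eapply le_trans; [norm_bound | ].
rewrite /DS_bound le_eqVlt; apply/orP; left; apply/eqP; by field.
Qed.

Lemma DSbar_residual_le :
  mxnorm ((1%:M - (X1 + X2) + h *: ((X1 + X2) *m (X1 + X2))) *m (G + D)
    *m (1%:M + (Y1 + Y2) + h *: ((Y1 + Y2) *m (Y1 + Y2))) - (G + (S1 + S2))) <=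
  DSbar_bound a b (kap ^+ 2 * w ^+ 3) (K * kap ^+ 4 * w ^+ 4) e.
Proof.
rewrite (DSbar_residual (erefl h) (erefl h4) first_order second_order second_rhs).
eapply le_trans; [norm_bound | ].
rewrite /DSbar_bound le_eqVlt; apply/orP; left; apply/eqP; by field.
Qed.
End ResidualBounds.

(** * Application to the iterates [DS] and [DSbar] *)

Section NewtonStep.
Set Implicit Arguments.
Unset Strict Implicit.
Variables (R : realType) (m n l q : nat) (hql : (q <= l)%N).
Local Notation C := R[i].
Variables (M : 'M[C]_(m, n)) (U : 'M[C]_(m, l)) (V : 'M[C]_(n, q)).
Variable Sigma : 'M[R]_(l, q).
Hypothesis diagSigma : diagonal_rect Sigma.
Hypothesis s_gt0 : forall i, 0 < diag hql Sigma i.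
Hypothesis s_inj : forall i j, i <> j -> diag hql Sigma i <> diag hql Sigma j.
Local Notation kap := (kappa hql Sigma).
Local Notation K := (bigK hql Sigma).
Local Notation w := (mxnorm (Delta M U V Sigma)).
Local Notation e := (kap * w).
Local Notation X1 := (X1 hql M U V Sigma).
Local Notation X2 := (X2 hql M U V Sigma).
Local Notation Y1 := (Y1 hql M U V Sigma).
Local Notation Y2 := (Y2 hql M U V Sigma).
Local Notation S1 := (toC (S1 M U V Sigma)).
Local Notation S2 := (toC (S2 hql M U V Sigma)).
Local Notation D2 := (rhs2 hql M U V Sigma).

Let toCD (A B : 'M[R]_(l, q)) : toC (A + B) = toC A + toC B.
Proof. by apply/matrixP => i j; rewrite !mxE rmorphD. Qed.

(** Separate [X] and [A] serve both iterations: the quadratic term uses [X1] in [DS] and [X1 + X2]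
    in [DSbar]. *)
Lemma residual_transport (X A : 'M[C]_l) (Z : 'M[C]_q) S :
  X ^t* = - X -> A ^t* = - A ->
  (U *m (1%:M + X + (1 / 2) *: (A *m A))) ^t* *m M *m (V *m Z)
    - toC (Sigma + S) =
  (1%:M - X + (1 / 2) *: (A *m A)) *m (toC Sigma + Delta M U V Sigma) *m Z
    - (toC Sigma + toC S).
Proof.
move=> skX skA; rewrite toCD /Delta [toC Sigma + (_ - _)]addrC subrK.
rewrite !(ctrmxM, ctrmxD) ctrmx_half ctrmxM skX skA.
by rewrite mulNmx mulmxN opprK trmx1 map_mx1 !mulmxA.
Qed.

Section Bounds.
Variables a b : R.
Hypothesis a_ge0 : 0 <= a.
Hypothesis b_ge0 : 0 <= b.
Hypothesis canX_bound : forall D, mxnorm (canX hql Sigma D) <= a * (kap * mxnorm D).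
Hypothesis canY_bound : forall D, mxnorm (canY hql Sigma D) <= b * (kap * mxnorm D).
Local Notation s := (a + b).

Let S1_le : mxnorm S1 <= w. Proof. exact: canS_le. Qed.

(** [Delta + S1] has norm at most [2 * w], which absorbs the two halves in [rhs2]. *)
Let D2_le : mxnorm D2 <= s * (kap * w ^+ 2).
Proof.
apply: le_trans (mxnormD_le (mxnormN_le (mxnorm_half_le (mxnormM_le (canX_bound _)
  (mxnormD_le (lexx _) S1_le)))) (mxnorm_half_le (mxnormM_le
  (mxnormD_le (lexx _) S1_le) (canY_bound _)))) _.
by rewrite -/(Delta M U V Sigma); lra.
Qed.

Let kap0 : 0 <= kap := kappa_ge0 hql Sigma.

Let X2_le : mxnorm X2 <= a * s * e ^+ 2.
Proof.
apply: le_trans (canX_bound _) _.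
have := ler_wpM2l (mulr_ge0 a_ge0 kap0) D2_le.
by rewrite -mulrA => /le_trans; apply; lra.
Qed.

Let Y2_le : mxnorm Y2 <= b * s * e ^+ 2.
Proof.
apply: le_trans (canY_bound _) _.
have := ler_wpM2l (mulr_ge0 b_ge0 kap0) D2_le.
by rewrite -mulrA => /le_trans; apply; lra.
Qed.

Let S2_le := le_trans (canS_le D2) D2_le.
Let DS2_le := le_trans (subr_canS_le D2) D2_le.
Let first_order := canonicalE diagSigma s_gt0 s_inj (Delta M U V Sigma).
Let second_order := canonicalE diagSigma s_gt0 s_inj D2.

Let X_skew : (X1 + X2) ^t* = - (X1 + X2).
Proof. by rewrite ctrmxD !canX_skew opprD. Qed.

Lemma DS_error : let: (U1, V1, Sigma1) := DS hql M U V Sigma in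
  mxnorm (U1 ^t* *m M *m V1 - toC Sigma1) <=
  DS_bound a b (kap ^+ 2 * w ^+ 3) (K * kap ^+ 3 * w ^+ 3) e.
Proof.
rewrite /DS residual_transport ?canX_skew // toCD.
exact: (DS_residual_le first_order second_order erefl (canX_bound _) (canY_bound _)
  X2_le Y2_le (toC_le_bigK diagSigma s_gt0) (lexx _) S1_le S2_le).
Qed.

Lemma DSbar_error :
  let: (U1, V1, Sigma1) := DSbar hql M U V Sigma in
  mxnorm (U1 ^t* *m M *m V1 - toC Sigma1) <=
  DSbar_bound a b (kap ^+ 2 * w ^+ 3) (K * kap ^+ 4 * w ^+ 4) e.
Proof.
rewrite /DSbar residual_transport // toCD.
exact: (DSbar_residual_le first_order second_order erefl (canX_bound _) (canY_bound _)
  X2_le Y2_le (toC_le_bigK diagSigma s_gt0) (lexx _) S1_le S2_le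
  (subr_canS_le _) DS2_le).
Qed.
End Bounds.

Hypothesis q_gt0 : (0 < q)%N.

Let bounds_q1 : (q <= 1)%N ->
  (forall D, mxnorm (canX hql Sigma D) <= 1 * (kap * mxnorm D)) /\
  (forall D, mxnorm (canY hql Sigma D) <= 1 / 2 * (kap * mxnorm D)).
Proof.
move=> q_le1; have q1 : q = 1%N by apply/eqP; rewrite eqn_leq q_le1.
by split=> D; [rewrite mul1r; exact: canX_le_q1|exact: canY_le_q1].
Qed.

Let bounds :
  (forall D, mxnorm (canX hql Sigma D) <= 3 / 2 * (kap * mxnorm D)) /\
  (forall D, mxnorm (canY hql Sigma D) <= 1 * (kap * mxnorm D)).
Proof. by split=> D; rewrite ?mul1r; [exact: canX_le|exact: canY_le]. Qed.

Let kap1 := kappa_ge1 hql Sigma.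
Let K1 := bigK_ge1 hql Sigma.
Let kap0 : 0 <= kap := le_trans ler01 kap1.
Let K0 : 0 <= K := le_trans ler01 K1.
Let w0 : 0 <= w := mxnorm_ge0 _.

Let scale_le (c eps mu x : R) k : 0 <= c -> c * w <= eps -> 0 <= mu ->
  x <= mu * c ^+ k -> x * w ^+ k <= mu * eps ^+ k.
Proof.
move=> c0 cw mu0 xc; apply: le_trans (ler_wpM2r (exprn_ge0 k w0) xc) _.
rewrite -mulrA -exprMn ler_wpM2l // lerXn2r // nnegrE ?mulr_ge0 //.
exact: le_trans (mulr_ge0 c0 w0) cw.
Qed.

Let scale1_le (c eps x : R) k : 0 <= c -> c * w <= eps ->
  x <= c ^+ k -> x * w ^+ k <= eps ^+ k.
Proof.
by move=> c0 cw xc; rewrite -[leRHS]mul1r (scale_le c0 cw) // mul1r.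
Qed.

Lemma DS_cubic (eps : R) :
  kap `^ (5 / 4) * K `^ (2 / 5) * w <= eps -> eps <= 1 / 10 ->
  let: (U1, V1, Sigma1) := DS hql M U V Sigma in
  mxnorm (U1 ^t* *m M *m V1 - toC Sigma1)
    <= (8 + 18 * eps + 33 * eps ^+ 2) * eps ^+ 3.
Proof.
set c := kap `^ _ * _ => cw eps_le.
have c0 : 0 <= c by rewrite mulr_ge0 ?powR_ge0.
have e0 : 0 <= e by rewrite mulr_ge0.
have ee : e <= eps := le_trans (ler_wpM2r w0 (DS_scale_ge kap1 K1)) cw.
have p0 : 0 <= kap ^+ 2 * w ^+ 3 by rewrite mulr_ge0 ?exprn_ge0.
have g0 : 0 <= K * kap ^+ 3 * w ^+ 3 by rewrite !mulr_ge0 ?exprn_ge0.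
case: (ltnP 1 q) => [q_gt1|/bounds_q1[boundX boundY]].
- have kK := kappa_bigK_ge s_gt0 s_inj q_gt1; have [boundX boundY] := bounds.
  apply: le_trans (DS_error _ _ boundX boundY) _; [by rewrite divr_ge0|by []|].
  apply: (DS_numeric p0 g0 e0 ee _ _).
    by apply: (scale_le c0 cw); rewrite ?divr_ge0 // DS_scale_sqr_gap.
  by apply: (scale_le c0 cw); rewrite ?divr_ge0 // DS_scale_cube_gap.
- apply: le_trans (DS_error _ _ boundX boundY) _; [by []|by rewrite divr_ge0|].
  apply: (DS_numeric_q1 p0 g0 e0 ee _ _).
    by apply: (scale1_le c0 cw); exact: DS_scale_sqr.
  by apply: (scale1_le c0 cw); exact: DS_scale_cube.
Qed.

Lemma DSbar_cubic (eps : R) :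
  kap `^ (6 / 5) * K `^ (3 / 10) * w <= eps -> eps <= 1 / 10 ->
  let: (U1, V1, Sigma1) := DSbar hql M U V Sigma in
  mxnorm (U1 ^t* *m M *m V1 - toC Sigma1)
    <= (6 + 21 * eps + 54 * eps ^+ 2) * eps ^+ 3.
Proof.
set c := kap `^ _ * _ => cw eps_le.
have c0 : 0 <= c by rewrite mulr_ge0 ?powR_ge0.
have e0 : 0 <= e by rewrite mulr_ge0.
have ee : e <= eps := le_trans (ler_wpM2r w0 (DSbar_scale_ge kap1 K1)) cw.
have p0 : 0 <= kap ^+ 2 * w ^+ 3 by rewrite mulr_ge0 ?exprn_ge0.
have g0 : 0 <= K * kap ^+ 4 * w ^+ 4 by rewrite !mulr_ge0 ?exprn_ge0.
have ge : K * kap ^+ 4 * w ^+ 4 <= eps ^+ 4.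
  by apply: (scale1_le c0 cw); exact: DSbar_scale_fourth.
case: (ltnP 1 q) => [q_gt1|/bounds_q1[boundX boundY]].
- have kK := kappa_bigK_ge s_gt0 s_inj q_gt1; have [boundX boundY] := bounds.
  apply: le_trans (DSbar_error _ _ boundX boundY) _; [by rewrite divr_ge0|by []|].
  apply: (DSbar_numeric p0 g0 e0 ee eps_le _ ge).
  by apply: (scale_le c0 cw); rewrite ?divr_ge0 // DSbar_scale_sqr_gap.
- apply: le_trans (DSbar_error _ _ boundX boundY) _; [by []|by rewrite divr_ge0|].
  apply: (DSbar_numeric_q1 p0 g0 e0 ee eps_le _ ge).
  by apply: (scale1_le c0 cw); exact: DSbar_scale_sqr.
Qed.

End NewtonStep.

Theorem theorem2p1 (R : realType) (m n l q : nat)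
    (hnm : (n <= m)%N) (hl1 : (1 <= l)%N) (hlm : (l <= m)%N)
    (hq1 : (1 <= q)%N) (hqn : (q <= n)%N) (hql : (q <= l)%N)
    (M : 'M[R[i]]_(m, n)) (U : 'M[R[i]]_(m, l)) (V : 'M[R[i]]_(n, q))
    (Sigma : 'M[R]_(l, q))
    (hSigma : diagonal_rect Sigma)
    (hpos : forall i : 'I_q, 0 < diag hql Sigma i)
    (hdist : forall i j : 'I_q, i <> j -> diag hql Sigma i <> diag hql Sigma j) :
  let eps1 := mxnorm (Delta M U V Sigma) in
  let kap := kappa hql Sigma in
  let K := bigK hql Sigma in
  (forall eps : R,
     kap `^ (5 / 4) * K `^ (2 / 5) * eps1 <= eps -> eps <= 1 / 10 ->
     let: (U1, V1, Sigma1) := DS hql M U V Sigma in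
     mxnorm (U1 ^t* *m M *m V1 - toC Sigma1)
       <= (8 + 18 * eps + 33 * eps ^+ 2) * eps ^+ 3) /\
  (forall eps : R,
     kap `^ (6 / 5) * K `^ (3 / 10) * eps1 <= eps -> eps <= 1 / 10 ->
     let: (U1, V1, Sigma1) := DSbar hql M U V Sigma in
     mxnorm (U1 ^t* *m M *m V1 - toC Sigma1)
       <= (6 + 21 * eps + 54 * eps ^+ 2) * eps ^+ 3).
Proof.
split=> eps; first exact: DS_cubic.
exact: DSbar_cubic.
Qed.
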